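(* Let $R$ be a finite commutative ring with $1$. Let $f=f_1+\alpha f_2$, where $f_1,f_2\in R[x]$. Then $f$ is a permutation polynomial on $R[\alpha]$ if and only if the following conditions hold: (1) $f_1$ is a permutation polynomial on $R$; (2) for all $a\in R$, $f_1'(a)$ is a unit of $R$.
   Context: For a commutative ring $R$ with $1$, the ring of dual numbers over $R$ is $R[\alpha]=R[x]/(x^2)$, where $\alpha=x+(x^2)$; so every element is uniquely $a+b\alpha$ with $a,b\in R$, and $\alpha^2=0$. A polynomial $f\in A[x]$ is a permutation polynomial on a ring $A$ if $a\mapsto f(a)$ is a bijection $A\to A$. $f'$ denotes the formal derivative of $f$. *)

(* Defs.v *)
From HB Require Import structures.
From mathcomp Require Import all_boot all_order all_algebra.
Set Implicit Arguments.
Unset Strict Implicit.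
Unset Printing Implicit Defensive.
Import GRing.Theory.
Local Open Scope ring_scope.

Definition permutation_poly (A : nzRingType) (f : {poly A}) : Prop :=
  bijective (fun a : A => f.[a]).

(* These are abbreviations rather than definitions, so that the ring and
   morphism instances of the library quotient are found. As 'X^2 is monic of
   size 3, the fallback of {poly %/ _} to the modulus 'X does not apply. *)
Notation dual_numbers R := {poly %/ ('X^2 : {poly R})} (only parsing).
Notation dual_const R := (qpolyC ('X^2 : {poly R})) (only parsing).
Notation dual_alpha R := (qpolyX ('X^2 : {poly R})) (only parsing).

Lemma dual_alpha_sqr (R : comNzRingType) : dual_alpha R ^+ 2 = 0.
Proof.
rewrite -(rmorphXn (in_qpoly 'X^2)); apply: val_inj => /=.
by rewrite mk_monic_Xn Pdiv.RingMonic.rmodpp ?monicXn.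
Qed.

Lemma dual_coef (R : comNzRingType) (a b : R) (i : nat) :
  (dual_const R a + dual_const R b * dual_alpha R)`_i =
  if i is i'.+1 then if i' is 0%N then b else 0 else a.
Proof.
rewrite poly_of_qpolyD poly_of_qpolyM /= -/(qpolyX _).
rewrite mk_monic_Xn /= (@Pdiv.CommonRing.rmodp_small _ 'X); last first.
  by rewrite size_polyX size_polyXn.
rewrite Pdiv.CommonRing.rmodp_small; last first.
  rewrite size_polyXn mul_polyC (leq_ltn_trans (size_scale_leq _ _)) //.
  by rewrite size_polyX.
by rewrite coefD coefC coefCM coefX; case: i => [|[|i]];
  rewrite /= ?mulr0 ?mulr1 ?addr0 ?add0r.
Qed.

Lemma dual_uniq_repr (R : comNzRingType) (u : dual_numbers R) :
  exists! ab : R * R,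
    u = dual_const R ab.1 + dual_const R ab.2 * dual_alpha R.
Proof.
have sz i : (1 < i)%N -> u`_i = 0.
  move=> i_gt1; apply: nth_default; apply: leq_trans i_gt1.
  move: (size_mk_monic u); move: (size u) => n.
  by rewrite mk_monic_Xn size_polyXn.
exists (u`_0, u`_1); split=> [|[a b] /= ->]; last by rewrite !dual_coef.
by apply/npolyP => -[|[|i]]; rewrite dual_coef //= sz.
Qed.

(* Main.v *)
Require Import Defs.
From HB Require Import structures.
From mathcomp Require Import all_boot all_order all_algebra.
From mathcomp Require Import ring.
Set Implicit Arguments.
Unset Strict Implicit.
Unset Printing Implicit Defensive.
Import GRing.Theory.
Local Open Scope ring_scope.

(* On R[alpha] the map f reads
     f (a + b alpha) = f1 a + (f2 a + f1' a * b) alpha,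
   so f is a bijection iff f1 is one and, for every a, multiplication by f1' a
   is one; on a finite ring the latter means that f1' a is a unit. *)

(** Taylor expansion at [x], exact at first order since every later term has the factor [h ^+ 2]. *)
Lemma horner_add_sqr0 (A : comNzRingType) (p : {poly A}) (x h : A) :
  h ^+ 2 = 0 -> p.[x + h] = p.[x] + p^`().[x] * h.
Proof.
move=> h2; elim/poly_ind: p => [|p c IHp].
  by rewrite deriv0 !horner0; ring.
rewrite derivD derivC derivM derivX mulr1 !hornerE IHp.
by ring: h2.
Qed.

Lemma horner_dual (R : comNzRingType) (f1 f2 : {poly R}) (a b : R) :
  (map_poly (dual_const R) f1 + dual_alpha R *: map_poly (dual_const R) f2)
    .[dual_const R a + dual_const R b * dual_alpha R] =
  dual_const R f1.[a] + dual_const R (f2.[a] + f1^`().[a] * b) * dual_alpha R.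
Proof.
set al := dual_alpha R.
have al2 : al ^+ 2 = 0 by exact: dual_alpha_sqr.
have bal2 : (dual_const R b * al) ^+ 2 = 0 by rewrite exprMn al2 mulr0.
rewrite hornerD hornerZ !horner_add_sqr0 // !deriv_map !horner_map.
rewrite mulrDr rmorphD rmorphM /=.
(* The derivative of [f2] enters only with a factor [al ^+ 2], so it vanishes. *)
rewrite [al * (_ * _)]mulrC -!mulrA -expr2 al2 !mulr0 addr0.
by rewrite mulrDl -addrA [al * _]mulrC [X in _ + X = _]addrC mulrA.
Qed.

Lemma dual_inj (R : comNzRingType) (a b c d : R) :
  dual_const R a + dual_const R b * dual_alpha R =
  dual_const R c + dual_const R d * dual_alpha R -> a = c /\ b = d.
Proof.
move=> e; have e_ i := congr1 (fun u : dual_numbers R => u`_i) e.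
by move: (e_ 0%N) (e_ 1%N); rewrite !dual_coef.
Qed.

(** By finiteness an injective multiplication is also onto, and a preimage of [1] is an inverse of
    [x]. *)
Lemma mulr_inj_unit (R : finComUnitRingType) (x : R) :
  injective ( *%R x) -> x \is a GRing.unit.
Proof.
by move=> /injF_bij[g _ gK]; apply/unitrPr; exists (g 1); apply: gK.
Qed.

Theorem theorem4p1 (R : finComUnitRingType) (f1 f2 : {poly R}) :
  let f : {poly (dual_numbers R)} :=
    map_poly (dual_const R) f1 + dual_alpha R *: map_poly (dual_const R) f2 in
  permutation_poly f <->
  (permutation_poly f1 /\ (forall a : R, f1^`().[a] \is a GRing.unit)).
Proof.
move=> f; pose dual (a b : R) := dual_const R a + dual_const R b * dual_alpha R.
have fE a b : f.[dual a b] = dual f1.[a] (f2.[a] + f1^`().[a] * b).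
  exact: horner_dual.
have dualE (u : dual_numbers R) : u = dual u`_0 u`_1.
  by have [[a b] [/= -> _]] := dual_uniq_repr u; rewrite /dual !dual_coef.
split=> [[g fK gK] | [[h f1K hK] f1'_unit]].
  split=> [|a].
    (* The constant part of the preimage of [dual c 0] under [f] is a preimage of [c] under [f1].
       This section of [f1] is injective, hence bijective as [R] is finite, and so [f1] is its
       inverse. *)
    have f1K : cancel (fun c => (g (dual c 0))`_0) (fun a => f1.[a]).
      by move=> c; move: (gK (dual c 0)); rewrite {1}[g _]dualE fE => /dual_inj[].
    have [k kK Kk] := injF_bij (can_inj f1K).
    by apply: (bij_can_bij _ f1K); exists k.
  apply: mulr_inj_unit => b b' eq_bb'.
  have /(can_inj fK)/dual_inj[] // : f.[dual a b] = f.[dual a b'].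
  by rewrite !fE eq_bb'.
exists (fun u : dual_numbers R => let a := h u`_0 in
          dual a (f1^`().[a]^-1 * (u`_1 - f2.[a]))) => u /=.
  rewrite [in RHS](dualE u) [in LHS](dualE u) fE /dual !dual_coef f1K.
  by rewrite addrAC subrr add0r mulKr.
by rewrite fE hK mulVKr // subrKC -dualE.
Qed.
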